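(* Let $X$, $A$, $B$, $C$, $\varepsilon$, $a$, $b$, $c$, $d$ be as in the context and define $Y$, $(\cdot|\cdot)$, $H$, $\hat B$, $V$ as in the context. Then: (i) $(Y,(\cdot|\cdot))$ is a complex Hilbert space. (ii) $H$ is densely defined, linear and self-adjoint in $Y$. (iii) $\hat B$ is linear; if $B$ is symmetric then $\hat B$ is symmetric; if $B$ is bounded then $\hat B$ is bounded and $|\hat B|\leqslant\|B\|$. (iv) $H+\hat B$ is closed; if $B$ is symmetric then $H+\hat B$ is self-adjoint. (v) $V$ is linear and bounded with $|V|\leqslant(c^2+d^2/\varepsilon)^{1/2}$.
   Context: $(X,\langle\cdot|\cdot\rangle)$ is a nontrivial complex Hilbert space with norm $\|\cdot\|$. $A:D(A)\to X$ is a densely defined self-adjoint linear operator with $\langle\xi|A\xi\rangle\geqslant\varepsilon\langle\xi|\xi\rangle$ for all $\xi\in D(A)$ for some $\varepsilon\in(0,\infty)$; $A^{1/2}$ is its positive self-adjoint square root. $B:D(A^{1/2})\to X$ is linear with $\|B\xi\|^2\leqslant a^2\|A^{1/2}\xi\|^2+b^2\|\xi\|^2$ for all $\xi\in D(A^{1/2})$, for some $a\in[0,1)$, $b\in\mathbb{R}$. $C:D(A^{1/2})\to X$ is linear with $\|C\xi\|^2\leqslant c^2\|A^{1/2}\xi\|^2+d^2\|\xi\|^2$ for all $\xi\in D(A^{1/2})$, for some real $c,d$. $Y:=D(A^{1/2})\times X$ with $(\xi|\eta):=\langle A^{1/2}\xi_1|A^{1/2}\eta_1\rangle+\langle\xi_2|\eta_2\rangle$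 for $\xi=(\xi_1,\xi_2),\eta=(\eta_1,\eta_2)\in Y$; $|\cdot|$ denotes the induced norm and operator norms on $Y$, $\|B\|$ the operator norm on $X$. $H:D(A)\times D(A^{1/2})\to Y$, $H\xi:=(-i\xi_2,iA\xi_1)$; $\hat B:D(H)\to Y$, $\hat B\xi:=(0,-B\xi_2)$; $V:Y\to Y$, $V\xi:=(0,iC\xi_1)$. *)

(* Defs.v *)
(* complex Hilbert spaces over C := R[i], R : realType. *)
From HB Require Import structures.
From mathcomp Require Import all_boot all_order all_algebra.
From mathcomp Require Import complex.
From mathcomp Require Import classical_sets reals.
Set Implicit Arguments. Unset Strict Implicit. Unset Printing Implicit Defensive.
Import Order.TTheory GRing.Theory Num.Theory.
Local Open Scope ring_scope.
Local Open Scope complex_scope.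
Local Open Scope classical_set_scope.

Section Defs.
Variable R : realType.
Local Notation C := (R[i]).
Variable V : lmodType C.
Variable ip : V -> V -> C.  (* conjugate-linear in 1st arg, linear in 2nd *)

(* induced norm *)
Definition nrm (x : V) : R := Num.sqrt (complex.Re (ip x x)).

(* E is a linear subspace of V *)
Definition subspace (E : set V) : Prop :=
  E 0 /\ (forall x y, E x -> E y -> E (x + y)) /\
  (forall (k : C) x, E x -> E (k *: x)).

Definition cauchy_seq (u : nat -> V) : Prop :=
  forall e : R, 0 < e -> exists N, forall m n, (N <= m)%N -> (N <= n)%N ->
    nrm (u m - u n) < e.

Definition converges_to (u : nat -> V) (l : V) : Prop :=
  forall e : R, 0 < e -> exists N, forall n, (N <= n)%N -> nrm (u n - l) < e.

(* (E, ip) is a complex Hilbert space: ip is an inner product on the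
   subspace E and E is complete for the induced norm *)
Definition hilbert_on (E : set V) : Prop :=
  subspace E /\
  (forall (k : C) x y z, E x -> E y -> E z ->
      ip x (k *: y + z) = k * ip x y + ip x z) /\
  (forall x y, E x -> E y -> ip y x = (ip x y)^*) /\
  (forall x, E x -> 0 <= ip x x) /\
  (forall x, E x -> ip x x = 0 -> x = 0) /\
  (forall u : nat -> V, (forall n, E (u n)) -> cauchy_seq u ->
      exists2 l, E l & converges_to u l).

(* f is linear on the domain D, a subspace of the ambient space E *)
Definition lin_on (E D : set V) (f : V -> V) : Prop :=
  D `<=` E /\ subspace D /\
  (forall x y, D x -> D y -> f (x + y) = f x + f y) /\
  (forall (k : C) x, D x -> f (k *: x) = k *: f x).

Definition dense_in (E D : set V) : Prop :=
  D `<=` E /\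
  forall x, E x -> forall e : R, 0 < e -> exists2 y, D y & nrm (x - y) < e.

(* symmetric (Hermitian) densely defined operator *)
Definition symmetric_on (E D : set V) (f : V -> V) : Prop :=
  dense_in E D /\ forall x y, D x -> D y -> ip (f x) y = ip x (f y).

(* self-adjoint: densely defined, linear, and its adjoint equals itself:
   (eta, z) is in the graph of f^* iff it is in the graph of f *)
Definition self_adjoint_on (E D : set V) (f : V -> V) : Prop :=
  lin_on E D f /\ dense_in E D /\
  forall eta z, E eta -> E z ->
    ((forall xi, D xi -> ip eta (f xi) = ip z xi) <-> (D eta /\ z = f eta)).

(* closed operator: closed graph *)
Definition closed_op (E D : set V) (f : V -> V) : Prop :=
  forall (u : nat -> V) x y, E x -> E y -> (forall n, D (u n)) ->
    converges_to u x -> converges_to (fun n => f (u n)) y ->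
    D x /\ f x = y.

Definition bounded_on (D : set V) (f : V -> V) : Prop :=
  exists M : R, forall x, D x -> nrm (f x) <= M * nrm x.

(* operator norm of f on its domain D *)
Definition opnorm (D : set V) (f : V -> V) : R :=
  sup [set nrm (f x) | x in [set x | D x /\ nrm x <= 1]].

End Defs.

Arguments nrm {R V} ip x.
Arguments subspace {R V} E.
Arguments cauchy_seq {R V} ip u.
Arguments converges_to {R V} ip u l.
Arguments hilbert_on {R V} ip E.
Arguments lin_on {R V} E D f.
Arguments dense_in {R V} ip E D.
Arguments symmetric_on {R V} ip E D f.
Arguments self_adjoint_on {R V} ip E D f.
Arguments closed_op {R V} ip E D f.
Arguments bounded_on {R V} ip D f.
Arguments opnorm {R V} ip D f.

(* Main.v *)
(* Coercivity of [A] makes it onto, hence [S = A^{1/2}] is a bijection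
   [D(S) -> X], with [eps |xi|^2 <= |S xi|^2]; so [(xi_1, xi_2) |-> (S xi_1, xi_2)]
   identifies [Y] with [X x X], which gives completeness and the density of [D(H)].
   Testing the adjoint relation of [H] on [(0, xi_2)] and [(xi_1, 0)] separately,
   self-adjointness of [S] and surjectivity of [A] yield [H^* = H].
   Since [|Bh y|^2 <= a^2 |H y|^2 + b^2 |y|^2] with [a < 1], [H + Bh] is closed, and
   the Kato-Rellich argument makes it self-adjoint when [B] is symmetric.
   All surjectivity statements ([A], [T + i mu]) come from one fact: a closed
   operator bounded below whose range has trivial orthogonal complement is onto. *)
Require Import Defs.
From HB Require Import structures.
From mathcomp Require Import all_boot all_order all_algebra.
From mathcomp Require Import complex ring lra.
From mathcomp Require Import boolp classical_sets reals.
Import Order.TTheory GRing.Theory Num.Theory.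
Local Open Scope ring_scope.
Local Open Scope complex_scope.
Local Open Scope classical_set_scope.

(** * Real inner product calculus on a Hilbert subspace *)

Section RealInnerProduct.
Context {R : realType} {V : lmodType R[i]} {ip : V -> V -> R[i]} {E : set V}.
Context (hE : hilbert_on ip E).

(** Estimates are run on the real part; the imaginary part comes back by multiplying one argument by
    ['i], as in [Im_ip] and [ip_eq0]. *)
Definition rdot (x y : V) : R := complex.Re (ip x y).

Lemma mem0 : E 0. Proof. by case: hE => -[]. Qed.
Lemma memD x y : E x -> E y -> E (x + y).
Proof. by case: hE => -[_ [hD _]] _; apply: hD. Qed.
Lemma memZ (k : R[i]) x : E x -> E (k *: x).
Proof. by case: hE => -[_ [_ hZ]] _; apply: hZ. Qed.
Lemma memN x : E x -> E (- x).
Proof. by move=> Ex; rewrite -scaleN1r; apply: memZ. Qed.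
Lemma memB x y : E x -> E y -> E (x - y).
Proof. by move=> Ex Ey; apply: memD => //; apply: memN. Qed.

Ltac mem := repeat first [solve [trivial] | apply: mem0 | apply: memB | apply: memD
  | apply: memN | apply: memZ].

Lemma ipDr x y z : E x -> E y -> E z -> ip x (y + z) = ip x y + ip x z.
Proof.
case: hE => _ [+ _] Ex Ey Ez => /(_ 1 x y z Ex Ey Ez).
by rewrite scale1r mul1r.
Qed.

Lemma ip0r x : E x -> ip x 0 = 0.
Proof.
move=> Ex; have := ipDr x 0 0 Ex mem0 mem0.
by rewrite addr0 -{1}[ip x 0]addr0 => /addrI.
Qed.

Lemma ipZr (k : R[i]) x y : E x -> E y -> ip x (k *: y) = k * ip x y.
Proof.
case: hE => _ [+ _] Ex Ey => /(_ k x y 0 Ex Ey mem0).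
by rewrite addr0 ip0r // addr0.
Qed.

Lemma ip_conj x y : E x -> E y -> ip y x = (ip x y)^*.
Proof. by case: hE => _ [_ [+ _]]; apply. Qed.

Lemma ipZl (k : R[i]) x y : E x -> E y -> ip (k *: x) y = k^* * ip x y.
Proof.
move=> Ex Ey; rewrite ip_conj; [|mem..].
by rewrite ipZr // rmorphM /= -ip_conj.
Qed.

Lemma Im_ip x y : E x -> E y -> complex.Im (ip x y) = rdot ('i *: x) y.
Proof.
by move=> Ex Ey; rewrite /rdot ipZl //; case: (ip x y) => u v /=; ring.
Qed.

Lemma rdotC x y : E x -> E y -> rdot x y = rdot y x.
Proof. by move=> Ex Ey; rewrite /rdot (ip_conj y x) //; case: (ip y x). Qed.

Lemma rdotDr x y z : E x -> E y -> E z -> rdot x (y + z) = rdot x y + rdot x z.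
Proof. by move=> Ex Ey Ez; rewrite /rdot ipDr //; case: (ip _ _); case: (ip _ _). Qed.

Lemma rdotDl x y z : E x -> E y -> E z -> rdot (y + z) x = rdot y x + rdot z x.
Proof. by move=> Ex Ey Ez; rewrite rdotC 1?rdotDr 1?(rdotC x) 1?(rdotC x z); mem. Qed.

Lemma rdotZr (t : R) x y : E x -> E y -> rdot x (t%:C *: y) = t * rdot x y.
Proof. by move=> Ex Ey; rewrite /rdot ipZr //; case: (ip _ _) => ? ? /=; ring. Qed.

Lemma rdotZl (t : R) x y : E x -> E y -> rdot (t%:C *: x) y = t * rdot x y.
Proof. by move=> Ex Ey; rewrite rdotC 1?rdotZr 1?(rdotC x); mem. Qed.

Lemma rdotNr x y : E x -> E y -> rdot x (- y) = - rdot x y.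
Proof. by move=> Ex Ey; rewrite -scaleN1r -(rmorphN1 (real_complex R)) rdotZr // mulN1r. Qed.

Lemma rdotNl x y : E x -> E y -> rdot (- x) y = - rdot x y.
Proof. by move=> Ex Ey; rewrite rdotC 1?rdotNr 1?(rdotC x); mem. Qed.

Lemma rdotBl x y z : E x -> E y -> E z -> rdot (y - z) x = rdot y x - rdot z x.
Proof. by move=> Ex Ey Ez; rewrite rdotDl 1?rdotNl; mem. Qed.

Lemma rdot_ir x y : E x -> E y -> rdot x ('i *: y) = - rdot ('i *: x) y.
Proof. by move=> Ex Ey; rewrite /rdot ipZr // ipZl //; case: (ip x y) => ? ? /=; ring. Qed.

Lemma ip_eq x y x' y' : E x -> E y -> E x' -> E y' ->
  rdot x y = rdot x' y' -> rdot ('i *: x) y = rdot ('i *: x') y' ->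
  ip x y = ip x' y'.
Proof.
move=> Ex Ey Ex' Ey' hre him; apply/eqP; rewrite eq_complex; apply/andP; split.
  by apply/eqP; exact: hre.
by rewrite !Im_ip // him.
Qed.

Lemma ip_eq0 x y : E x -> E y -> rdot x y = 0 -> rdot x ('i *: y) = 0 ->
  ip x y = 0.
Proof.
move=> Ex Ey hre; rewrite rdot_ir // -Im_ip // => /eqP; rewrite oppr_eq0 => him.
by apply/eqP; rewrite eq_complex him andbT; apply/eqP.
Qed.

Lemma rdot_ge0 x : E x -> 0 <= rdot x x.
Proof.
move=> Ex; case: hE => _ [_ [_ [/(_ x Ex) + _]]].
by rewrite lecE => /andP[].
Qed.

Lemma rdot_eq0 x : E x -> rdot x x = 0 -> x = 0.
Proof.
move=> Ex h; case: hE => _ [_ [_ [h0 [/(_ x Ex) + _]]]]; apply.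
move/(_ x Ex): h0 => /ger0_Im; move: h; rewrite /rdot.
by case: (ip x x) => u v /= -> ->.
Qed.

Lemma nrm_ge0 x : 0 <= nrm ip x.
Proof. exact: sqrtr_ge0. Qed.

Lemma nrm_sq x : E x -> nrm ip x ^+ 2 = rdot x x.
Proof. by move=> Ex; rewrite sqr_sqrtr //; apply: rdot_ge0. Qed.

Lemma nrm0 : nrm ip 0 = 0.
Proof. by rewrite /nrm ip0r ?sqrtr0 //; exact: mem0. Qed.

Lemma nrm_eq0 x : E x -> nrm ip x <= 0 -> x = 0.
Proof.
move=> Ex h; apply: rdot_eq0 => //; rewrite -nrm_sq //.
by have -> : nrm ip x = 0 by [have := nrm_ge0 x; lra]; rewrite expr0n.
Qed.

Lemma nrmN x : E x -> nrm ip (- x) = nrm ip x.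
Proof.
move=> Ex; rewrite /nrm -/(rdot _ _) rdotNl 1?rdotNr ?opprK //; mem.
Qed.

Lemma nrm_subC x y : E x -> E y -> nrm ip (x - y) = nrm ip (y - x).
Proof. by move=> Ex Ey; rewrite -opprB nrmN //; mem. Qed.

Lemma nrmZ (k : R[i]) x : E x -> nrm ip (k *: x) = complex.Re `|k| * nrm ip x.
Proof.
move=> Ex; apply/eqP; rewrite -(@eqrXn2 _ 2) ?mulr_ge0 ?nrm_ge0 //; last first.
  by rewrite normc_def /= sqrtr_ge0.
rewrite exprMn !nrm_sq //; mem.
rewrite /rdot ipZl ?ipZr //; mem.
rewrite normc_def /= sqr_sqrtr ?addr_ge0 ?sqr_ge0 //.
by case: k (ip x x) => [? ?] [? ?] /=; apply/eqP; ring.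
Qed.

Lemma nrmD_sq x y : E x -> E y ->
  nrm ip (x + y) ^+ 2 = nrm ip x ^+ 2 + nrm ip y ^+ 2 + 2 * rdot x y.
Proof.
move=> Ex Ey; rewrite !nrm_sq //; mem.
rewrite rdotDl ?rdotDr //; mem.
by rewrite (rdotC y x) //; ring.
Qed.

Lemma nrmB_sq x y : E x -> E y ->
  nrm ip (x - y) ^+ 2 = nrm ip x ^+ 2 + nrm ip y ^+ 2 - 2 * rdot x y.
Proof. by move=> Ex Ey; rewrite nrmD_sq ?nrmN ?rdotNr //; mem; ring. Qed.

Lemma cauchy_schwarz x y : E x -> E y -> `|rdot x y| <= nrm ip x * nrm ip y.
Proof.
move=> Ex Ey; rewrite -(@ler_pXn2r _ 2) ?nnegrE ?mulr_ge0 ?nrm_ge0 //.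
rewrite real_normK ?num_real // exprMn.
have [y0|y0] := eqVneq (nrm ip y) 0.
  by rewrite (nrm_eq0 y) ?y0 // /rdot ip0r //= nrm0; lra.
have ypos : 0 < nrm ip y by rewrite lt_def y0 nrm_ge0.
(* Expanding this square gives [|y|^2] times the difference of the two sides; scaling [x] by [|y|^2]
   avoids a quotient. *)
have := sqr_ge0 (nrm ip ((nrm ip y ^+ 2)%:C *: x - (rdot x y)%:C *: y)).
rewrite nrmB_sq //; mem.
rewrite !nrm_sq //; mem.
rewrite !rdotZl ?rdotZr -?nrm_sq //; mem.
set r := rdot x y; set u := nrm ip x; set v := nrm ip y.
have -> : v ^+ 2 * (v ^+ 2 * u ^+ 2) + r * (r * v ^+ 2) - 2 * (v ^+ 2 * (r * r)) =
  v ^+ 2 * (u ^+ 2 * v ^+ 2 - r ^+ 2) by ring.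
by rewrite pmulr_rge0 ?exprn_gt0 // subr_ge0.
Qed.

Lemma nrmD x y : E x -> E y -> nrm ip (x + y) <= nrm ip x + nrm ip y.
Proof.
move=> Ex Ey; rewrite -(@ler_pXn2r _ 2) ?nnegrE ?addr_ge0 ?nrm_ge0 //.
rewrite nrmD_sq // sqrrD.
by have := le_trans (ler_norm _) (cauchy_schwarz x y Ex Ey); lra.
Qed.

Lemma nrm_triangle z x y : E x -> E y -> E z ->
  nrm ip (x - y) <= nrm ip (x - z) + nrm ip (z - y).
Proof.
move=> Ex Ey Ez; have -> : x - y = (x - z) + (z - y) by rewrite addrA subrK.
by apply: nrmD; mem.
Qed.


(** * Convergent and Cauchy sequences *)

Lemma linear_comb_lt (k l e : R) : 0 <= k -> 0 <= l -> 0 < e ->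
  exists2 dl, 0 < dl & forall s t, s < dl -> t < dl -> k * s + l * t < e.
Proof.
move=> k0 l0 e0; have kl : 0 < k + l + 1 by lra.
(* The [+ 1] keeps the divisor positive when [k = l = 0]. *)
exists (e / (k + l + 1)); first by rewrite divr_gt0.
move=> s t /ltW hs /ltW ht; set dl := e / _ in hs ht.
have edl : e = k * dl + l * dl + dl by rewrite /dl; field; rewrite gt_eqF.
have dl0 : 0 < dl by rewrite divr_gt0.
rewrite edl; apply: (@le_lt_trans _ _ (k * dl + l * dl)); last by lra.
by apply: lerD; apply: ler_wpM2l.
Qed.

Lemma cvg_dominated (k l : R) u v w x y z : 0 <= k -> 0 <= l ->
  converges_to ip u x -> converges_to ip v y ->
  (forall n, nrm ip (w n - z) <= k * nrm ip (u n - x) + l * nrm ip (v n - y)) ->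
  converges_to ip w z.
Proof.
move=> k0 l0 ux vy hw e e0.
have [dl dl0 hdl] := linear_comb_lt k l e k0 l0 e0.
have [N hN] := ux dl dl0; have [M hM] := vy dl dl0.
exists (maxn N M) => n; rewrite geq_max => /andP[Nn Mn].
by apply: le_lt_trans (hw n) _; apply: hdl; [apply: hN|apply: hM].
Qed.

Lemma cauchy_dominated (k l : R) (u v w : nat -> V) : 0 <= k -> 0 <= l ->
  cauchy_seq ip u -> cauchy_seq ip v ->
  (forall m n, nrm ip (w m - w n) <=
     k * nrm ip (u m - u n) + l * nrm ip (v m - v n)) ->
  cauchy_seq ip w.
Proof.
move=> k0 l0 cu cv hw e e0.
have [dl dl0 hdl] := linear_comb_lt k l e k0 l0 e0.
have [N hN] := cu dl dl0; have [M hM] := cv dl dl0.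
exists (maxn N M) => m n; rewrite !geq_max => /andP[Nm Mm] /andP[Nn Mn].
by apply: le_lt_trans (hw m n) _; apply: hdl; [apply: hN|apply: hM].
Qed.

Lemma cvg_cauchy u x : (forall n, E (u n)) -> E x ->
  converges_to ip u x -> cauchy_seq ip u.
Proof.
move=> Eu Ex ux e e0.
have [N hN] := ux (e / 2) (divr_gt0 e0 (ltr0Sn _ 1)).
exists N => m n Nm Nn; have := nrm_triangle x (u m) (u n) (Eu m) (Eu n) Ex.
rewrite (nrm_subC x) //; have := hN m Nm; have := hN n Nn; lra.
Qed.

Lemma cauchy_cvg u : (forall n, E (u n)) -> cauchy_seq ip u ->
  exists2 l, E l & converges_to ip u l.
Proof. by case: hE => _ [_ [_ [_ [_ +]]]]; apply. Qed.

Lemma cvg_unique u x y : (forall n, E (u n)) -> E x -> E y ->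
  converges_to ip u x -> converges_to ip u y -> x = y.
Proof.
move=> Eu Ex Ey ux uy; apply/eqP; rewrite -subr_eq0; apply/eqP.
apply: nrm_eq0; first by mem.
apply/ler_addgt0Pr => e e0; rewrite add0r.
have [N hN] := ux (e / 2) (divr_gt0 e0 (ltr0Sn _ 1)).
have [M hM] := uy (e / 2) (divr_gt0 e0 (ltr0Sn _ 1)).
have := nrm_triangle (u (maxn N M)) x y Ex Ey (Eu _).
rewrite (nrm_subC x (u _)) //.
by have := hN _ (leq_maxl N M); have := hM _ (leq_maxr N M); lra.
Qed.

(** The difference of the limits equals [rdot (v n - y) b - rdot (u n - x) a], which is small by
    Cauchy-Schwarz. *)
Lemma cvg_rdot u v x y a b : (forall n, E (u n)) -> (forall n, E (v n)) ->
  E x -> E y -> E a -> E b -> converges_to ip u x -> converges_to ip v y ->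
  (forall n, rdot (u n) a = rdot (v n) b) -> rdot x a = rdot y b.
Proof.
move=> Eu Ev Ex Ey Ea Eb ux vy huv.
apply/eqP; rewrite -subr_eq0 -normr_le0; apply/ler_addgt0Pr => e e0.
rewrite add0r.
have [dl dl0 hdl] := linear_comb_lt _ _ e (nrm_ge0 a) (nrm_ge0 b) e0.
have [N hN] := ux dl dl0; have [M hM] := vy dl dl0.
have {hdl} := hdl _ _ (hN _ (leq_maxl N M)) (hM _ (leq_maxr N M)).
set n := maxn N M; move=> /ltW; apply: le_trans.
have -> : rdot x a - rdot y b = rdot (v n - y) b - rdot (u n - x) a.
  by rewrite !rdotBl // huv; ring.
apply: le_trans (ler_normB _ _) _; rewrite addrC.
by apply: lerD; rewrite mulrC; apply: cauchy_schwarz; mem.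
Qed.

(** * Orthogonal projection onto a complete subspace *)

Lemma orth_projection (W : set V) y : W `<=` E -> subspace W ->
  (forall u, (forall n, W (u n)) -> cauchy_seq ip u ->
     exists2 l, W l & converges_to ip u l) ->
  E y -> exists2 w, W w & forall v, W v -> ip (y - w) v = 0.
Proof.
move=> WE [W0 [WD WZ]] Wc Ey.
(* A minimising sequence for the distance to [y] is Cauchy, so [W] contains a nearest point;
   perturbing that point inside [W] gives orthogonality. *)
pose Q : set R := [set nrm ip (y - w) ^+ 2 | w in W].
have Qlb : has_lbound Q by exists 0 => _ [w _ <-]; exact: sqr_ge0.
have Qinf : has_inf Q by split=> //; exists (nrm ip (y - 0) ^+ 2); exists 0.
have dleQ w : W w -> inf Q <= nrm ip (y - w) ^+ 2.
  by move=> Ww; apply: ge_inf => //; exists w.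
have min_seq n : {w | W w & nrm ip (y - w) ^+ 2 < inf Q + n.+1%:R^-1}.
  apply: cid2; have n0 : (0 : R) < n.+1%:R^-1 by rewrite invr_gt0.
  have [_ [w Ww <-] hw] := inf_adherent n0 Qinf.
  by exists w.
pose u n := s2val (min_seq n).
have Wu n : W (u n) by rewrite /u; case: (min_seq n).
have du n : nrm ip (y - u n) ^+ 2 < inf Q + n.+1%:R^-1.
  by rewrite /u; case: (min_seq n).
have Eu n : E (u n) by apply: WE.
have small (e : R) : 0 < e -> exists N, forall n, (N <= n)%N -> n.+1%:R^-1 < e.
  move=> e0; exists (Num.truncn e^-1) => n hn.
  rewrite -[ltRHS]invrK ltf_pV2 ?posrE ?invr_gt0 //.
  by rewrite -truncn_le_nat.
(* parallelogram identity around [y]; the midpoint lies in [W] *)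
have par m n : nrm ip (u m - u n) ^+ 2 <= 2 * m.+1%:R^-1 + 2 * n.+1%:R^-1.
  have Wmid : W ((2^-1)%:C *: (u m + u n)) by apply: WZ; apply: WD.
  have := dleQ _ Wmid.
  rewrite !nrmB_sq ?nrm_sq //; mem.
  have -> : 2 * rdot y ((2^-1)%:C *: (u m + u n)) = rdot y (u m) + rdot y (u n).
    by rewrite rdotZr ?rdotDr; mem; field.
  rewrite rdotZl ?rdotZr ?rdotDl ?rdotDr; mem.
  rewrite (rdotC (u n) (u m)) //.
  have := du m; have := du n; rewrite !nrmB_sq ?nrm_sq //.
  move: (rdot _ _) (rdot _ _) (rdot _ _) (rdot _ _) (rdot _ _) (rdot _ _).
  move: (m.+1%:R^-1) (n.+1%:R^-1) => ? ? ? ? ? ? ? ?.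
  by lra.
have cu : cauchy_seq ip u.
  move=> e e0; have e40 : 0 < e ^+ 2 / 4 by rewrite divr_gt0 ?exprn_gt0.
  have [N hN] := small _ e40; exists N => m n Nm Nn.
  rewrite -(@ltr_pXn2r _ 2) ?nnegrE ?nrm_ge0 ?ltW //.
  apply: le_lt_trans (par m n) _.
  have := hN m Nm; have := hN n Nn.
  by move: (m.+1%:R^-1) (n.+1%:R^-1) => ? ?; lra.
have [w Ww uw] := Wc u Wu cu; have Ew := WE _ Ww.
have dw : nrm ip (y - w) ^+ 2 <= inf Q.
  have Q0 : 0 <= inf Q.
    by apply: lb_le_inf; [case: Qinf | move=> _ [? _ <-]; exact: sqr_ge0].
  have dist_le : nrm ip (y - w) <= Num.sqrt (inf Q).
    (* For large [n], [|u n - w| < e / 2] and [|y - u n|^2 < inf Q + (e / 2)^2 <= (sqrt (inf Q) + e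
       / 2)^2]. *)
    apply/ler_addgt0Pr => e e0.
    have e20 : 0 < e / 2 by rewrite divr_gt0.
    have [N hN] := uw _ e20.
    have [M hM] := small _ (exprn_gt0 2 e20).
    set n := maxn N M.
    have hn1 := hN n (leq_maxl _ _); have hn2 := hM n (leq_maxr _ _).
    have := nrm_triangle (u n) y w Ey Ew (Eu n).
    have : nrm ip (y - u n) <= Num.sqrt (inf Q) + e / 2.
      rewrite -(@ler_pXn2r _ 2) ?nnegrE ?nrm_ge0 ?addr_ge0 ?sqrtr_ge0 ?ltW //.
      rewrite sqrrD (sqr_sqrtr Q0).
      have : 0 <= Num.sqrt (inf Q) * (e / 2) by rewrite mulr_ge0 ?sqrtr_ge0 ?ltW.
      by move: hn2 (du n); move: (n.+1%:R^-1) => ?; lra.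
    by lra.
  by rewrite -[leRHS](sqr_sqrtr Q0) ler_pXn2r ?nnegrE ?nrm_ge0 ?sqrtr_ge0.
exists w => //.
have orth v : W v -> rdot (y - w) v = 0.
  move=> Wv; have Ev := WE _ Wv.
  have var (t : R) : 0 <= t * (t * nrm ip v ^+ 2 - 2 * rdot (y - w) v).
    have /dleQ : W (w + t%:C *: v) by apply: WD => //; apply: WZ.
    rewrite opprD addrA nrmB_sq; mem.
    rewrite rdotZr; mem; rewrite (nrm_sq (t%:C *: v)); mem.
    by rewrite rdotZl ?rdotZr -?nrm_sq; mem; move: dw; lra.
  set r := rdot (y - w) v in var *; set q := nrm ip v ^+ 2 in var.
  have q0 : 0 <= q by exact: sqr_ge0.
  (* The parabola is minimal at [r / q]; [q + 1] replaces [q], which vanishes for [v = 0], and still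
     makes the value a negative multiple of [r^2]. *)
  have := var (r / (q + 1)).
  have -> : r / (q + 1) * (r / (q + 1) * q - 2 * r) =
            - (r ^+ 2 * ((q + 2) / (q + 1) ^+ 2)).
    by field; rewrite gt_eqF //; lra.
  rewrite oppr_ge0 pmulr_lle0; last by rewrite divr_gt0 ?exprn_gt0 //; lra.
  by move=> r2; apply/eqP; rewrite -sqrf_eq0 eq_le r2 sqr_ge0.
move=> v Wv; have Ev := WE _ Wv.
(* Testing with [v] and with ['i *: v], both in [W], kills the real and the imaginary part. *)
by apply: ip_eq0; mem; apply: orth => //; apply: WZ.
Qed.


(** * Range, adjoint and closedness of operators *)

Lemma ipDl x y z : E x -> E y -> E z -> ip (y + z) x = ip y x + ip z x.
Proof.
move=> Ex Ey Ez; rewrite ip_conj; mem.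
by rewrite ipDr // rmorphD /= -!ip_conj.
Qed.

Lemma ipNl x y : E x -> E y -> ip (- x) y = - ip x y.
Proof.
by move=> Ex Ey; rewrite -scaleN1r ipZl // rmorphN1 mulN1r.
Qed.

Lemma ip_real x y : E x -> E y -> ip x y = ip y x -> complex.Im (ip x y) = 0.
Proof.
by move=> Ex Ey; rewrite (ip_conj x y) //; case: (ip x y) => u v /= [] ?; lra.
Qed.

Lemma orth_full x : E x -> (forall y, E y -> ip x y = 0) -> x = 0.
Proof. by move=> Ex h; apply: rdot_eq0 => //; rewrite /rdot h. Qed.

Lemma lin_onB (D : set V) f x y : lin_on E D f -> D x -> D y ->
  D (x - y) /\ f (x - y) = f x - f y.
Proof.
move=> [_ [[_ [DD DZ]] [fD fZ]]] Dx Dy.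
have DNy : D (- y) by rewrite -scaleN1r; apply: DZ.
split; first exact: DD.
by rewrite fD // -[- y]scaleN1r fZ // scaleN1r.
Qed.

(** The lower bound makes preimages of a Cauchy sequence of values Cauchy, and closedness puts the
    limit in the graph, so the range is complete. The residual of projecting [y] onto the range is
    orthogonal to it, hence zero. *)
Lemma range_full (D : set V) f (k : R) : lin_on E D f ->
  (forall x, D x -> E (f x)) -> closed_op ip E D f ->
  0 < k -> (forall x, D x -> k * nrm ip x <= nrm ip (f x)) ->
  (forall z, E z -> (forall x, D x -> ip z (f x) = 0) -> z = 0) ->
  forall y, E y -> exists2 x, D x & f x = y.
Proof.
move=> lf Ef cf k0 lower orth y Ey.
have [DE [[D0 [DD DZ]] [fD fZ]]] := lf.
have Wsub : subspace (f @` D).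
  split; first by exists 0 => //; have := fZ 0 0 D0; rewrite !scale0r.
  split=> [_ _ [x Dx <-] [z Dz <-]|c _ [x Dx <-]].
    by exists (x + z); [apply: DD | rewrite fD].
  by exists (c *: x); [apply: DZ | rewrite fZ].
have WE : f @` D `<=` E by move=> _ [x Dx <-]; apply: Ef.
have Wc v : (forall n, (f @` D) (v n)) -> cauchy_seq ip v ->
    exists2 l, (f @` D) l & converges_to ip v l.
  move=> Wv cv; have pre n : {x | D x & f x = v n} by apply: cid2; exact: Wv.
  pose u n := s2val (pre n).
  have Du n : D (u n) by rewrite /u; case: (pre n).
  have fu n : f (u n) = v n by rewrite /u; case: (pre n).
  have Eu n : E (u n) by apply: DE.
  have Ev n : E (v n) by apply: WE.
  have cu : cauchy_seq ip u.
    apply: (cauchy_dominated k^-1 0 v v) => // [|m n]; first by rewrite invr_ge0 ltW.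
    rewrite mul0r addr0 -ler_pdivrMl ?invr_gt0 // invrK.
    have [Dmn fmn] := lin_onB D f (u m) (u n) lf (Du m) (Du n).
    by rewrite -!fu -fmn; apply: lower.
  have [x Ex ux] := cauchy_cvg u Eu cu; have [l El vl] := cauchy_cvg v Ev cv.
  exists l => //; have [Dx <-] : D x /\ f x = l; last by exists x.
  have fuv : (fun n => f (u n)) = v by apply/funext.
  by apply: (cf u) => //; rewrite fuv.
have [_ [x Dx <-] hx] := orth_projection _ y WE Wsub Wc Ey.
exists x => //; apply/eqP; rewrite eq_sym -subr_eq0; apply/eqP.
apply: orth => [|z Dz]; last by apply: hx; exists z.
by apply: memB => //; apply: Ef.
Qed.

Lemma self_adjoint_sym (D : set V) f x y : self_adjoint_on ip E D f ->
  (forall x, D x -> E (f x)) -> D x -> D y -> ip (f x) y = ip x (f y).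
Proof.
move=> [[DE _] [_ sa]] Ef Dx Dy.
by have [_ ->] := sa x (f x) (DE _ Dx) (Ef _ Dx).
Qed.

(** Symmetry along the sequence passes to the limit, so [(x, y)] satisfies the adjoint relation,
    which self-adjointness turns into membership in the graph. *)
Lemma self_adjoint_closed (D : set V) f : self_adjoint_on ip E D f ->
  (forall x, D x -> E (f x)) -> closed_op ip E D f.
Proof.
move=> fsa Ef u x y Ex Ey Du ux fuy; have [[DE [[_ [_ DZ]] _]] [_ sa]] := fsa.
have Eu n : E (u n) by apply: DE.
have Efu n : E (f (u n)) by apply: Ef.
have Eiu n : E ('i *: u n) by mem.
have Eifu n : E ('i *: f (u n)) by mem.
have [+ _] := sa x y Ex Ey; case=> [xi Dxi|Dx ->]; last by [].
have Exi := DE _ Dxi; have Efxi := Ef _ Dxi.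
have sym n : ip (u n) (f xi) = ip (f (u n)) xi.
  by rewrite (self_adjoint_sym _ _ _ _ fsa).
have cvgi v z : (forall n, E (v n)) -> E z -> converges_to ip v z ->
    converges_to ip (fun n => 'i *: v n) ('i *: z).
  move=> Ev Ez vz; apply: (cvg_dominated 1 0 v v _ z z) => // n.
  by rewrite -scalerBr nrmZ; mem; rewrite mul0r addr0 normc_def /= expr0n /=
    add0r expr1n sqrtr1.
apply: ip_eq => //.
  apply: (cvg_rdot u (fun n => f (u n))) => // n.
  by rewrite /rdot sym.
(* The imaginary part is the real-part argument for the sequences multiplied by ['i]. *)
apply: (cvg_rdot (fun n => 'i *: u n) (fun n => 'i *: f (u n))); mem.
- exact: cvgi.
- exact: cvgi.
- by move=> n; rewrite /rdot !ipZl // sym.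
Qed.

Lemma closed_shift (D : set V) f (k : R[i]) : D `<=` E ->
  (forall x, D x -> E (f x)) -> closed_op ip E D f ->
  closed_op ip E D (fun x => f x + k *: x).
Proof.
move=> DE Ef cf u x y Ex Ey Du ux fuy.
have Eu n : E (u n) by apply: DE.
have Efu n : E (f (u n)) by apply: Ef.
have [] := cf u x (y - k *: x) Ex _ Du ux; [by mem| |by move=> Dx ->; rewrite subrK].
apply: (cvg_dominated 1 (complex.Re `|k|) _ _ _ _ _ _ _ _ fuy ux) => // [|n].
  by rewrite normc_def /= sqrtr_ge0.
have -> : f (u n) - (y - k *: x) =
    (f (u n) + k *: u n - y) - k *: (u n - x).
  rewrite scalerBr !opprB [k *: x - k *: _]addrC [RHS]addrA [_ + _ - y]addrAC addrK.
  by rewrite -[RHS]addrA [- y + _]addrC.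
rewrite mul1r -nrmZ; mem.
by rewrite -[X in _ <= _ + X]nrmN; mem; apply: nrmD; mem.
Qed.

(** * Shifts by imaginary multiples of the identity *)

Lemma nrm_shift x z (mu : R) : E x -> E z -> ip z x = ip x z ->
  nrm ip (z + mu*i *: x) ^+ 2 = nrm ip z ^+ 2 + mu ^+ 2 * nrm ip x ^+ 2.
Proof.
(* [ip z x] is real, so the cross term, the real part of [mu*i * ip z x], vanishes. *)
move=> Ex Ez sym; have im := ip_real z x Ez Ex sym.
rewrite nrmD_sq; mem; rewrite nrmZ // exprMn normc_def /= expr0n /= add0r.
rewrite (sqr_sqrtr (sqr_ge0 mu)) /rdot ipZr //.
by move: im; case: (ip _ _) => p q /= ->; ring.
Qed.

Lemma lin_on_shift (D : set V) f (k : R[i]) : lin_on E D f ->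
  lin_on E D (fun x => f x + k *: x).
Proof.
move=> [DE [Ds [fD fZ]]]; split=> //; split=> //; split=> [x y Dx Dy|c x Dx].
  by rewrite fD // scalerDr addrACA.
by rewrite fZ // scalerDr !scalerA mulrC.
Qed.

Lemma nrm_shift_lower x z (mu : R) : E x -> E z -> ip z x = ip x z ->
  `|mu| * nrm ip x <= nrm ip (z + mu*i *: x).
Proof.
move=> Ex Ez sym; rewrite -(@ler_pXn2r _ 2) ?nnegrE ?mulr_ge0 ?nrm_ge0 //.
by rewrite nrm_shift // exprMn real_normK ?num_real // lerDr sqr_ge0.
Qed.

(** [nrm_shift_lower] supplies the constant [|mu|] for [range_full]. What remains is the
    orthogonality condition, which is checked differently for self-adjoint and for perturbed
    operators. *)
Lemma shift_onto (D : set V) f (mu : R) : lin_on E D f ->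
  (forall x, D x -> E (f x)) -> closed_op ip E D f ->
  (forall x, D x -> ip (f x) x = ip x (f x)) -> mu != 0 ->
  (forall z, E z -> (forall x, D x -> ip z (f x + mu*i *: x) = 0) -> z = 0) ->
  forall y, E y -> exists2 x, D x & f x + mu*i *: x = y.
Proof.
move=> lf Ef cf sym mu0 orth; have [DE _] := lf.
apply: (@range_full D (fun x => f x + mu*i *: x) `|mu|) => //.
- exact: lin_on_shift.
- by move=> x Dx; apply: memD; [apply: Ef | apply: memZ; apply: DE].
- exact: closed_shift.
- by rewrite normr_gt0.
- by move=> x Dx; apply: nrm_shift_lower; [apply: DE|apply: Ef|apply: sym].
Qed.

(** By the adjoint relation, a vector [z] orthogonal to the range lies in [D] with
    [f z = mu*i *: z], and a symmetric operator has no eigenvalue off the real line. *)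
Lemma self_adjoint_shift_onto (D : set V) f (mu : R) :
  self_adjoint_on ip E D f -> (forall x, D x -> E (f x)) -> mu != 0 ->
  forall y, E y -> exists2 x, D x & f x + mu*i *: x = y.
Proof.
move=> fsa Ef mu0; have [lf [_ sa]] := fsa; have [DE _] := lf.
apply: shift_onto => //; first exact: self_adjoint_closed.
  by move=> x Dx; apply: self_adjoint_sym fsa _ _ _.
move=> z Ez orth; have [+ _] := sa z (mu*i *: z) Ez (memZ _ _ Ez).
case=> [x Dx|Dz fz].
  have Ex := DE _ Dx; have Efx := Ef _ Dx.
  have := orth _ Dx; rewrite ipDr ?ipZr ?ipZl; mem.
  move/eqP; rewrite addr_eq0 => /eqP ->.
  by case: (ip z x) => p q; apply/eqP; rewrite eq_complex /=;
    apply/andP; split; apply/eqP; ring.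
have sym : ip (f z) z = ip z (f z) by apply: self_adjoint_sym fsa _ _ _.
have Efz := Ef _ Dz.
(* The shift by [- mu] annihilates [z], so the lower bound forces [z = 0]. *)
have := nrm_shift_lower _ _ (- mu) Ez Efz sym.
have -> : (- mu)*i = - mu*i by apply/eqP; rewrite eq_complex /= oppr0 !eqxx.
rewrite scaleNr -fz subrr nrm0 normrN pmulr_rle0 ?normr_gt0 //.
exact: nrm_eq0.
Qed.

(** For [eta] in the domain of the adjoint, with value [z], solve [(f - i mu) xi = z - i mu eta] in
    [D]. Then [eta - xi] is orthogonal to the range of [f + i mu], which is everything, so
    [eta = xi]. *)
Lemma symmetric_onto_self_adjoint (D : set V) f (mu : R) : lin_on E D f ->
  (forall x, D x -> E (f x)) -> symmetric_on ip E D f ->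
  (forall y, E y -> exists2 x, D x & f x + mu*i *: x = y) ->
  (forall y, E y -> exists2 x, D x & f x + (- mu)*i *: x = y) ->
  self_adjoint_on ip E D f.
Proof.
move=> lf Ef [dD sym] onto ontoN; split=> //; split=> //.
have [DE _] := lf; move=> eta z Eeta Ez; split=> [adj|[Deta ->] xi Dxi]; last first.
  by rewrite sym.
have [xi Dxi hxi] := ontoN (z + (- mu)*i *: eta) (memD _ _ Ez (memZ _ _ Eeta)).
have Exi := DE _ Dxi; have Efxi := Ef _ Dxi.
have eta_xi : eta - xi = 0.
  apply: orth_full => [|y Ey]; first by mem.
  have [x Dx <-] := onto y Ey; have Ex := DE _ Dx; have Efx := Ef _ Dx.
  have : ip (f xi + (- mu)*i *: xi) x = ip (z + (- mu)*i *: eta) x by rewrite hxi.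
  rewrite !ipDl ?ipDr ?ipNl ?ipZl ?ipZr; mem.
  rewrite adj // -sym // => /eqP; rewrite -subr_eq0 => /eqP e0.
  rewrite -[RHS]oppr0 -e0.
  by case: (ip eta x) (ip xi x) (ip z x) (ip (f xi) x) => [? ?] [? ?] [? ?] [? ?];
    apply/eqP; rewrite eq_complex /=; apply/andP; split; apply/eqP; ring.
move/eqP: eta_xi; rewrite subr_eq0 => /eqP eta_xi; rewrite eta_xi in hxi *.
by split=> //; move/addIr: hxi.
Qed.

(** * Relatively bounded perturbations *)

Lemma closed_perturbation (D : set V) f p (a b : R) :
  lin_on E D f -> lin_on E D p ->
  (forall x, D x -> E (f x)) -> (forall x, D x -> E (p x)) ->
  closed_op ip E D f -> 0 <= a -> a < 1 ->
  (forall x, D x -> nrm ip (p x) ^+ 2 <=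
     a ^+ 2 * nrm ip (f x) ^+ 2 + b ^+ 2 * nrm ip x ^+ 2) ->
  closed_op ip E D (fun x => f x + p x).
Proof.
move=> lf lp Ef Ep cf a0 a1 rel u x y Ex Ey Du ux fpy.
have [DE _] := lf.
(* Square roots turn the quadratic bound into a linear one, as the cross term on the right is
   nonnegative. *)
have rel1 z : D z -> nrm ip (p z) <= a * nrm ip (f z) + `|b| * nrm ip z.
  move=> Dz; rewrite -(@ler_pXn2r _ 2) ?nnegrE ?addr_ge0 ?mulr_ge0 ?nrm_ge0 //.
  apply: le_trans (rel z Dz) _.
  rewrite sqrrD !exprMn real_normK ?num_real //.
  have : 0 <= a * nrm ip (f z) * (`|b| * nrm ip z) by rewrite !mulr_ge0 ?nrm_ge0.
  by lra.
have Eu n : E (u n) by apply: DE.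
have Efu n : E (f (u n)) by apply: Ef.
have Epu n : E (p (u n)) by apply: Ep.
have Efpu n : E (f (u n) + p (u n)) by mem.
(* This rests on [(1 - a) * |f z| <= |f z + p z| + |b| * |z|], applied to differences. *)
have cfu : cauchy_seq ip (fun n => f (u n)).
  apply: (cauchy_dominated (1 - a)^-1 ((1 - a)^-1 * `|b|) _ _ _ _ _
    (cvg_cauchy _ _ Efpu Ey fpy) (cvg_cauchy _ _ Eu Ex ux)) => [||m n].
  - by rewrite invr_ge0; lra.
  - by rewrite mulr_ge0 // invr_ge0; lra.
  have [Dmn fmn] := lin_onB _ _ _ _ lf (Du m) (Du n).
  have [_ pmn] := lin_onB _ _ _ _ lp (Du m) (Du n).
  rewrite -mulrA -mulrDr -ler_pdivrMl ?invr_gt0 ?invrK; last by lra.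
  have := rel1 _ Dmn; rewrite pmn fmn.
  have -> : f (u m) + p (u m) - (f (u n) + p (u n)) =
    (f (u m) - f (u n)) + (p (u m) - p (u n)) by rewrite opprD addrACA.
  set s := f _ - f _; set t := p _ - p _ => ht.
  have Es : E s by rewrite /s; mem.
  have Et : E t by rewrite /t; mem.
  have := nrmD (s + t) (- t) (memD _ _ Es Et) (memN _ Et).
  by rewrite addrK nrmN //; lra.
have [l El fl] := cauchy_cvg _ Efu cfu.
have [Dx fx] := cf u x l Ex El Du ux fl; split=> //.
have Efx := Ef _ Dx; have Epx := Ep _ Dx.
(* By the relative bound [p (u n)] tends to [p x], so [f (u n) + p (u n)] tends both to [f x + p x]
   and to [y]. *)
apply: (cvg_unique (fun n => f (u n) + p (u n))) => //; first by mem.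
apply: (cvg_dominated (1 + a) `|b| _ _ _ _ _ _ _ _ fl ux) => // [|n]; first by lra.
have [Dn fn] := lin_onB _ _ _ _ lf (Du n) Dx.
have [_ pn] := lin_onB _ _ _ _ lp (Du n) Dx.
rewrite opprD addrACA -pn.
have := rel1 _ Dn; rewrite fn fx => hp.
have Epn := Ep _ Dn.
by apply: le_trans (nrmD _ _ _ _) _; mem; lra.
Qed.

Lemma lin_onD (D : set V) f p : lin_on E D f -> lin_on E D p ->
  lin_on E D (fun x => f x + p x).
Proof.
move=> [DE [Ds [fD fZ]]] [_ [_ [pD pZ]]].
split=> //; split=> //; split=> [x y Dx Dy|c x Dx].
  by rewrite fD // pD // addrACA.
by rewrite fZ // pZ // scalerDr.
Qed.

(* With [z = (f + i mu) x], orthogonality of [z] to [(f + p + i mu) x = z + p x]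
   gives [|z| <= |p x| <= q |z|], [q < 1] once [mu] is large. *)
Lemma kato_rellich (D : set V) f p (a b : R) :
  self_adjoint_on ip E D f -> lin_on E D p ->
  (forall x, D x -> E (f x)) -> (forall x, D x -> E (p x)) ->
  symmetric_on ip E D p -> 0 <= a -> a < 1 ->
  (forall x, D x -> nrm ip (p x) ^+ 2 <=
     a ^+ 2 * nrm ip (f x) ^+ 2 + b ^+ 2 * nrm ip x ^+ 2) ->
  self_adjoint_on ip E D (fun x => f x + p x).
Proof.
move=> fsa lp Ef Ep [dD psym] a0 a1 rel.
have [lf _] := fsa; have [DE _] := lf.
have fsym := self_adjoint_sym _ _ _ _ fsa Ef.
have lfp := lin_onD _ _ _ lf lp.
have Efp x : D x -> E (f x + p x) by move=> Dx; apply: memD; [apply: Ef|apply: Ep].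
have sym x y : D x -> D y -> ip (f x + p x) y = ip x (f y + p y).
  move=> Dx Dy; rewrite ipDl ?ipDr ?fsym ?psym //;
    by [apply: DE|apply: Ef|apply: Ep].
have cfp : closed_op ip E D (fun x => f x + p x).
  by apply: closed_perturbation a0 a1 rel => //; apply: self_adjoint_closed.
(* Here [a < q < 1], and [nu] is taken so that [|b| <= q * nu]; then [a^2 |f x|^2 + b^2 |x|^2 <= q^2
   (|f x|^2 + nu^2 |x|^2)], which is [q^2 |z|^2] by [nrm_shift]. *)
pose q := (1 + a) / 2.
have q0 : 0 < q by rewrite /q; lra.
have q1 : q < 1 by rewrite /q; lra.
have aq : a ^+ 2 <= q ^+ 2 by rewrite ler_pXn2r ?nnegrE // /q; lra.
pose nu := `|b| / q + 1.
have nu0 : 0 < nu by rewrite ltr_wpDl // divr_ge0 // ltW.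
have bq : b ^+ 2 <= q ^+ 2 * nu ^+ 2.
  rewrite -exprMn -[b ^+ 2]real_normK ?num_real // ler_pXn2r ?nnegrE //.
    by rewrite /nu mulrDr mulrCA divff ?gt_eqF // mulr1; lra.
  by rewrite mulr_ge0 // ltW.
(* The estimate depends on [mu^2] alone, so the shifts by [nu] and [- nu] are treated at once. *)
have onto mu : mu ^+ 2 = nu ^+ 2 -> forall y, E y ->
    exists2 x, D x & f x + p x + mu*i *: x = y.
  move=> munu; have mu0 : mu != 0.
    by rewrite -sqrf_eq0 munu sqrf_eq0 gt_eqF.
  apply: (shift_onto D (fun x => f x + p x)) => //.
    by move=> x Dx; apply: sym.
  move=> z Ez orth.
  have [x Dx hx] := self_adjoint_shift_onto _ _ mu fsa Ef mu0 z Ez.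
  have := orth x Dx; rewrite addrAC hx => ort.
  have Epx := Ep _ Dx.
  have nz := nrm_shift x (f x) mu (DE _ Dx) (Ef _ Dx) (fsym x x Dx Dx).
  rewrite hx munu in nz.
  have le1 : nrm ip z ^+ 2 <= nrm ip (p x) ^+ 2.
    have := sqr_ge0 (nrm ip (z + p x)); rewrite nrmD_sq //.
    have : rdot z (z + p x) = 0 by rewrite /rdot ort.
    by rewrite rdotDr // -nrm_sq //; lra.
  have le2 : nrm ip (p x) ^+ 2 <= q ^+ 2 * nrm ip z ^+ 2.
    apply: le_trans (rel x Dx) _; rewrite nz mulrDr mulrA.
    by apply: lerD; apply: ler_wpM2r => //; exact: sqr_ge0.
  apply: nrm_eq0 => //; rewrite leNgt; apply/negP => z0.
  have := le_trans le1 le2; rewrite leNgt gtr_pMl ?exprn_gt0 //.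
  by rewrite expr_lt1 ?(ltW q0) // q1.
apply: (symmetric_onto_self_adjoint _ _ nu) => //.
  exact: onto.
by apply: onto; rewrite sqrrN.
Qed.

Lemma opnorm_le (D : set V) f (M : R) : D 0 -> 0 <= M ->
  (forall x, D x -> nrm ip (f x) <= M * nrm ip x) -> opnorm ip D f <= M.
Proof.
move=> D0 M0 hM; apply: ge_sup.
  by exists (nrm ip (f 0)); exists 0 => //; split=> //; rewrite nrm0.
move=> _ [x [Dx x1] <-]; apply: le_trans (hM x Dx) _.
by rewrite ler_piMr.
Qed.

End RealInnerProduct.

(** * The operator [A] and its square root [S] *)

Section WaveOperator.
Context {R : realType} {X : lmodType R[i]} {ipX : X -> X -> R[i]}.
Context {DA : set X} {A : X -> X} {DS : set X} {S : X -> X} {eps : R}.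
Context (hX : hilbert_on ipX setT).
Context (Asa : self_adjoint_on ipX setT DA A) (eps0 : 0 < eps).
Context (Alower : forall xi, DA xi -> eps%:C * ipX xi xi <= ipX xi (A xi)).
Context (Ssa : self_adjoint_on ipX setT DS S).
Context (DAE : forall xi, DA xi <-> (DS xi /\ DS (S xi))).
Context (AE : forall xi, DA xi -> A xi = S (S xi)).

Local Notation nrmX := (nrm ipX).

Lemma DS_lin : lin_on setT DS S. Proof. by case: Ssa. Qed.

Lemma DS_subspace : subspace DS. Proof. by case: DS_lin => _ []. Qed.

Lemma S_0 : S 0 = 0.
Proof.
have [_ [[D0 _] [_ SZ]]] := DS_lin.
by have := SZ 0 0 D0; rewrite !scale0r.
Qed.

Lemma DA_subspace : subspace DA. Proof. by case: Asa => -[_ []]. Qed.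

Lemma DA_DS x : DA x -> DS x. Proof. by move/DAE => []. Qed.

Lemma S_sym x y : DS x -> DS y -> ipX (S x) y = ipX x (S y).
Proof. by move=> Dx Dy; apply: (self_adjoint_sym _ _ _ _ Ssa). Qed.

Lemma A_lower_rdot x : DA x -> eps * nrmX x ^+ 2 <= rdot (ip := ipX) x (A x).
Proof.
move=> Dx; have := Alower x Dx; rewrite lecE => /andP[_].
rewrite (nrm_sq hX) // /rdot.
by case: (ipX x x) => p q /=; rewrite mul0r subr0.
Qed.

Lemma A_lower x : DA x -> eps * nrmX x <= nrmX (A x).
Proof.
move=> Dx; have [x0|x0] := eqVneq (nrmX x) 0.
  by rewrite x0 mulr0 nrm_ge0.
have xpos : 0 < nrmX x by rewrite lt_def x0 nrm_ge0.
rewrite -(ler_pM2l xpos) mulrCA -expr2.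
apply: le_trans (A_lower_rdot x Dx) _.
exact: le_trans (ler_norm _) (cauchy_schwarz hX _ _ I I).
Qed.

(** A vector orthogonal to the range is in the kernel of the adjoint, which is [A] itself, and
    coercivity makes that kernel trivial. *)
Lemma A_onto y : exists2 x, DA x & A x = y.
Proof.
have [lA [_ sa]] := Asa.
apply: (range_full hX _ _ eps lA) => //.
- exact: (self_adjoint_closed hX).
- exact: A_lower.
move=> z _ orth; have [+ _] := sa z 0 I I; case=> [x Dx|Dz Az].
  by rewrite orth // (ip_conj hX x) // (ip0r hX) // conjc0.
apply: (nrm_eq0 hX) => //; rewrite -(pmulr_rle0 _ eps0).
by apply: le_trans (A_lower z Dz) _; rewrite -Az (nrm0 hX).
Qed.

Lemma S_onto y : exists2 x, DS x & S x = y.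
Proof.
have [x Dx <-] := A_onto y; exists (S x); last by rewrite AE.
by case/DAE: Dx.
Qed.

(* Writing [xi = S zeta], so that [S xi = A zeta], the bound comes from
   [0 <= |A zeta - eps zeta|^2] and [eps |zeta|^2 <= <zeta | A zeta>]. *)
Lemma S_lower xi : DS xi -> eps * nrmX xi ^+ 2 <= nrmX (S xi) ^+ 2.
Proof.
move=> Dxi; have [z Dz zE] := S_onto xi.
have DAz : DA z by apply/DAE; rewrite zE.
have AzE : A z = S xi by rewrite AE // zE.
have rd : rdot (ip := ipX) z (A z) = nrmX xi ^+ 2.
  by rewrite AzE (nrm_sq hX) // /rdot -S_sym // zE.
have := sqr_ge0 (nrmX (A z - eps%:C *: z)).
rewrite (nrmB_sq hX) // (rdotZr hX) // (rdotC hX) // rd AzE.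
rewrite (nrmZ hX) // normc_def /= expr0n /= addr0 exprMn.
rewrite (sqr_sqrtr (sqr_ge0 eps)).
have := A_lower_rdot z DAz; rewrite rd -(ler_pM2l eps0).
by lra.
Qed.

Lemma S_inj xi : DS xi -> S xi = 0 -> xi = 0.
Proof.
move=> Dxi Sxi; have := S_lower xi Dxi; rewrite Sxi (nrm0 hX) expr0n /=.
rewrite pmulr_rle0 // => h; apply: (nrm_eq0 hX) => //.
by have := sqr_ge0 (nrmX xi); have := nrm_ge0 (ip := ipX) xi; nra.
Qed.

(** * The energy space and its completeness *)

Definition energy_dom : set (X * X)%type := [set y | DS y.1].
Definition energy_ip (y z : X * X) : R[i] := ipX (S y.1) (S z.1) + ipX y.2 z.2.
Definition wave_dom : set (X * X)%type := [set y | DA y.1 /\ DS y.2].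
(** ['i *: wave_op y] is [(y.2, - A y.1)], the first-order form of [u'' + A u = 0] for
    [y = (u, u')]. *)
Definition wave_op (y : X * X) : X * X :=
  (- (Complex 0 1) *: y.2, (Complex 0 1) *: A y.1).

Local Notation nrmY := (nrm energy_ip).

Lemma nrmY_sq y : nrmY y ^+ 2 = nrmX (S y.1) ^+ 2 + nrmX y.2 ^+ 2.
Proof.
rewrite !(nrm_sq hX) // sqr_sqrtr /energy_ip.
  by rewrite /rdot; case: (ipX _ _); case: (ipX _ _).
have := rdot_ge0 hX (S y.1) I; have := rdot_ge0 hX y.2 I; rewrite /rdot.
by case: (ipX _ _) => p1 q1; case: (ipX _ _) => p2 q2 /=; lra.
Qed.

Lemma nrmY_fst y : nrmX (S y.1) <= nrmY y.
Proof.
rewrite -(@ler_pXn2r _ 2) ?nnegrE ?nrm_ge0 //.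
by rewrite nrmY_sq lerDl sqr_ge0.
Qed.

Lemma nrmY_snd y : nrmX y.2 <= nrmY y.
Proof.
rewrite -(@ler_pXn2r _ 2) ?nnegrE ?nrm_ge0 //.
by rewrite nrmY_sq lerDr sqr_ge0.
Qed.

Lemma nrmY_lt y e : nrmX (S y.1) < e / 2 -> nrmX y.2 < e / 2 -> nrmY y < e.
Proof.
move=> h1 h2; have e0 := le_lt_trans (nrm_ge0 (ip := ipX) _) h1.
have le_e : 0 <= e by lra.
rewrite -(@ltr_pXn2r _ 2) ?nnegrE ?nrm_ge0 //.
rewrite nrmY_sq.
(* Two squares below [(e / 2)^2] sum to less than [e^2 / 2]. *)
have h3 : nrmX (S y.1) ^+ 2 < (e / 2) ^+ 2 by rewrite ltr_pXn2r ?nnegrE ?nrm_ge0 ?ltW.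
have h4 : nrmX y.2 ^+ 2 < (e / 2) ^+ 2 by rewrite ltr_pXn2r ?nnegrE ?nrm_ge0 ?ltW.
by have := sqr_ge0 e; lra.
Qed.

Lemma energy_subspace : subspace energy_dom.
Proof.
have [D0 [DD DZ]] := DS_subspace.
by split; [|split] => // [x y|k x]; [apply: DD|apply: DZ].
Qed.

Lemma energy_hilbert : hilbert_on energy_ip energy_dom.
Proof.
have [_ [[D0 [DD DZ]] [SD SZ]]] := DS_lin.
split; first exact: energy_subspace.
split=> [k x y z Dx Dy Dz|].
  rewrite /energy_ip /= SD ?SZ //; last exact: DZ.
  by rewrite !(ipDr hX) // !(ipZr hX) // mulrDr addrACA.
split=> [x y Dx Dy|].
  by rewrite /energy_ip rmorphD /= -!(ip_conj hX).
have ip_ge0 x : 0 <= ipX x x by case: hX => _ [_ [_ [+ _]]]; apply.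
split=> [x Dx|]; first by rewrite addr_ge0.
split=> [x Dx /eqP|u Du cu].
  rewrite paddr_eq0 // => /andP[/eqP h1 /eqP h2].
  have ip_inj z : ipX z z = 0 -> z = 0.
    by case: hX => _ [_ [_ [_ [+ _]]]]; apply.
  by apply: injective_projections; [apply: S_inj => //; apply: ip_inj | apply: ip_inj].
have SB m n : S (u m - u n).1 = S (u m).1 - S (u n).1.
  by have [_ ->] := lin_onB _ _ (u m).1 (u n).1 DS_lin (Du m) (Du n).
have [l1 _ ul1] : exists2 l, setT l & converges_to ipX (fun n => S (u n).1) l.
  apply: (cauchy_cvg hX) => // e e0; have [N hN] := cu e e0; exists N => m n Nm Nn.
  by rewrite -SB; apply: le_lt_trans (nrmY_fst _) (hN m n Nm Nn).
have [l2 _ ul2] : exists2 l, setT l & converges_to ipX (fun n => (u n).2) l.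
  apply: (cauchy_cvg hX) => // e e0; have [N hN] := cu e e0; exists N => m n Nm Nn.
  by apply: le_lt_trans (nrmY_snd (u m - u n)) (hN m n Nm Nn).
(* The energy norm sees the first component through [S], so its limit is a preimage under [S] of the
   limit of [S (u n).1]. *)
have [x Dx Sx] := S_onto l1; exists (x, l2) => // e e0.
have [N hN] := ul1 (e / 2) (divr_gt0 e0 (ltr0Sn _ 1)).
have [M hM] := ul2 (e / 2) (divr_gt0 e0 (ltr0Sn _ 1)).
exists (maxn N M) => n; rewrite geq_max => /andP[Nn Mn].
apply: nrmY_lt; last exact: hM.
have [_ ->] := lin_onB _ _ (u n).1 x DS_lin (Du n) Dx.
by rewrite Sx; apply: hN.
Qed.

(** * Density of the domain and self-adjointness of the wave operator *)

Lemma wave_dom_energy : wave_dom `<=` energy_dom.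
Proof. by move=> y [/DA_DS]. Qed.

Lemma wave_dom_subspace : subspace wave_dom.
Proof.
have [A0 [AD AZ]] := DA_subspace; have [D0 [DD DZ]] := DS_subspace.
split=> //; split=> [x y [x1 x2] [y1 y2]|k x [x1 x2]]; split=> /=.
- exact: AD.
- exact: DD.
- exact: AZ.
- exact: DZ.
Qed.

Lemma wave_dom_dense : dense_in energy_ip energy_dom wave_dom.
Proof.
split; first exact: wave_dom_energy.
move=> [x1 x2] /= Dx1 e e0; have [_ [[_ dDS] _]] := Ssa.
have e2 := divr_gt0 e0 (ltr0Sn _ 1).
(* [S x1] is approximated rather than [x1]: a preimage under [S] of a point [s] of [DS] lies in
   [DA]. *)
have [s Ds hs] := dDS (S x1) I _ e2; have [y2 Dy2 hy2] := dDS x2 I _ e2.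
have [y1 Dy1 Sy1] := S_onto s; exists (y1, y2).
  by split=> //; apply/DAE; rewrite Sy1.
apply: nrmY_lt => //=; rewrite -Sy1 in hs.
by have [_ ->] := lin_onB _ _ x1 y1 DS_lin Dx1 Dy1.
Qed.

Lemma wave_op_energy y : wave_dom y -> energy_dom (wave_op y).
Proof. by move=> [_ Dy]; have [_ [_ +]] := DS_subspace; apply. Qed.

Lemma wave_op_lin : lin_on energy_dom wave_dom wave_op.
Proof.
split; first exact: wave_dom_energy.
split; first exact: wave_dom_subspace.
have [[_ [_ [AD AZ]]] _] := Asa.
split=> [x y [x1 x2] [y1 y2]|k x [x1 x2]].
  by rewrite /wave_op /= AD // !scalerDr.
rewrite /wave_op /= AZ // !scalerA.
by apply: injective_projections; rewrite /= scalerA mulrC.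
Qed.

Lemma nrmY_wave_op y : wave_dom y ->
  nrmY (wave_op y) ^+ 2 = nrmX (S y.2) ^+ 2 + nrmX (A y.1) ^+ 2.
Proof.
move=> [_ Dy2]; have [_ [_ [_ SZ]]] := DS_lin.
rewrite nrmY_sq /= SZ // !(nrmZ hX) // normrN normc_def /=.
by rewrite expr0n /= add0r expr1n sqrtr1 !mul1r.
Qed.

Lemma wave_op_self_adjoint : self_adjoint_on energy_ip energy_dom wave_dom wave_op.
Proof.
split; first exact: wave_op_lin.
split; first exact: wave_dom_dense.
have [_ [[D0 [DD DZ]] [SD SZ]]] := DS_lin; have [A0 _] := DA_subspace.
have [[_ [_ [_ AZ]]] _] := Asa.
have Az0 : A 0 = 0 by have := AZ 0 0 A0; rewrite !scale0r.
have ip0l x : ipX 0 x = 0 by rewrite (ip_conj hX x) // (ip0r hX) // conjc0.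
move=> [e1 e2] [z1 z2] /= De1 Dz1; split=> [adj|[[De1A De2] [-> ->]] [x1 x2] [Dx1 Dx2]].
  (* Testing on [(0, x2)] says that ['i *: S e1] is in the domain of the adjoint of [S], with value
     [z2]. *)
  have e1z2 : DS ('i *: S e1) /\ z2 = S ('i *: S e1).
    have [_ [_ sa]] := Ssa; apply/sa => // x2 Dx2.
    have := adj (0, x2) (conj A0 Dx2); rewrite /energy_ip /= S_0 Az0.
    rewrite scaler0 !(ip0r hX) // addr0 add0r => <-.
    by rewrite SZ // (ipZl hX) // (ipZr hX) //; congr (_ * _); congr Complex; rewrite ?oppr0.
  have De1A : DA e1.
    apply/DAE; split=> //; case: e1z2 => /(DZ (- 'i)) + _.
    by rewrite scalerA mulNr -expr2 sqr_i opprK scale1r.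
  (* Testing on [(x1, 0)] makes [z1 + 'i *: e2] orthogonal to every [A x1], hence to all of [X]. *)
  have z1e2 : z1 + 'i *: e2 = 0.
    apply: (orth_full hX) => // y _; have [x1 Dx1 <-] := A_onto y.
    have := adj (x1, 0) (conj Dx1 D0); rewrite /energy_ip /= scaler0 S_0.
    rewrite !(ip0r hX) // add0r addr0 S_sym //; last by case/DAE: Dx1.
    rewrite -AE // (ipZr hX) // (ipDl hX) // (ipZl hX) // => <-.
    by case: (ipX _ _) => p q; apply/eqP; rewrite eq_complex /=;
      apply/andP; split; apply/eqP; ring.
  have z1E : z1 = - 'i *: e2.
    by apply/eqP; rewrite scaleNr -addr_eq0 z1e2.
  split; last by rewrite /wave_op /= -z1E (proj2 e1z2) SZ ?AE //; case/DAE: De1A.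
  (* [e2] is ['i *: z1], and [z1] lies in [DS]. *)
  split=> //=; have := DZ 'i _ Dz1.
  by rewrite z1E scalerA mulrN -expr2 sqr_i opprK scale1r.
rewrite /energy_ip /= !SZ // !(ipZl hX) // !(ipZr hX) //.
have De1S : DS (S e1) by case/DAE: De1A.
have Dx1S : DS (S x1) by case/DAE: Dx1.
rewrite (AE x1) // (AE e1) // -(S_sym e2) // (S_sym (S e1)) //.
case: (ipX _ _) => p q; case: (ipX _ _) => p' q'.
by apply/eqP; rewrite eq_complex /=; apply/andP; split; apply/eqP; ring.
Qed.

Lemma nrmY_inr x : nrmY (0, x) = nrmX x.
Proof.
apply/eqP; rewrite -(@eqrXn2 _ 2) ?nrm_ge0 // nrmY_sq /= S_0 (nrm0 hX).
by rewrite expr0n /= add0r.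
Qed.

(** * The damping and potential terms *)

Definition damping_op (B : X -> X) (y : X * X) : X * X := (0, - B y.2).

Lemma nrmY_damping B y : nrmY (damping_op B y) = nrmX (B y.2).
Proof. by rewrite nrmY_inr (nrmN hX). Qed.

Lemma damping_energy B y : energy_dom (damping_op B y).
Proof. by have [] := DS_subspace. Qed.

Lemma damping_lin B : lin_on setT DS B -> lin_on energy_dom wave_dom (damping_op B).
Proof.
move=> [_ [_ [BD BZ]]].
split; first exact: wave_dom_energy.
split; first exact: wave_dom_subspace.
split=> [x y [_ x2] [_ y2]|k x [_ x2]]; apply: injective_projections => /=.
- by rewrite addr0.
- by rewrite BD // opprD.
- by rewrite scaler0.
- by rewrite BZ // scalerN.
Qed.

Lemma damping_symmetric B : symmetric_on ipX setT DS B ->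
  symmetric_on energy_ip energy_dom wave_dom (damping_op B).
Proof.
move=> [_ sym]; split; first exact: wave_dom_dense.
move=> x y [_ x2] [_ y2]; rewrite /energy_ip /= S_0.
rewrite (ip_conj hX (S y.1)) // !(ip0r hX) // conjc0 !add0r.
by rewrite (ipNl hX) // sym // -[- B y.2]scaleN1r (ipZr hX) // mulN1r.
Qed.

Lemma damping_bounded B : bounded_on ipX DS B ->
  bounded_on energy_ip wave_dom (damping_op B).
Proof.
(* [bounded_on] allows a negative [M]; passing to its absolute value makes multiplication
   monotone. *)
move=> [M hM]; exists `|M| => y [_ y2]; rewrite nrmY_damping.
apply: le_trans (hM _ y2) _.
apply: le_trans (ler_wpM2r (nrm_ge0 _) (ler_norm M)) _.
by apply: ler_wpM2l => //; exact: nrmY_snd.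
Qed.

Lemma damping_opnorm B : bounded_on ipX DS B ->
  opnorm energy_ip wave_dom (damping_op B) <= opnorm ipX DS B.
Proof.
move=> [M hM]; apply: ge_sup.
  have [D0 _] := wave_dom_subspace.
  exists (nrmY (damping_op B 0)); exists 0 => //; split=> //.
  by rewrite (nrm0 energy_hilbert).
move=> _ [y [[_ y2] y1] <-]; rewrite nrmY_damping; apply: ub_le_sup.
  (* Boundedness of [B] bounds the set behind the right-hand norm, so that its [sup] dominates each
     value. *)
  exists `|M| => _ [x [Dx x1] <-]; apply: le_trans (hM x Dx) _.
  apply: le_trans (ler_wpM2r (nrm_ge0 _) (ler_norm M)) _.
  by rewrite ler_piMr.
by exists y.2 => //; split=> //; apply: le_trans (nrmY_snd y) y1.
Qed.

(** By [nrmY_wave_op] and [nrmY_sq] the squared norms on the right dominate [|S y.2|^2] and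
    [|y.2|^2], so the bound for [B] at [y.2] carries over with the same constants. *)
Lemma damping_rel_bound B (a b : R) :
  (forall xi, DS xi ->
     nrmX (B xi) ^+ 2 <= a ^+ 2 * nrmX (S xi) ^+ 2 + b ^+ 2 * nrmX xi ^+ 2) ->
  forall y, wave_dom y -> nrmY (damping_op B y) ^+ 2 <=
    a ^+ 2 * nrmY (wave_op y) ^+ 2 + b ^+ 2 * nrmY y ^+ 2.
Proof.
move=> rel y Dy; rewrite nrmY_damping nrmY_wave_op // nrmY_sq.
apply: le_trans (rel _ (proj2 Dy)) _.
by apply: lerD; apply: ler_wpM2l; rewrite ?sqr_ge0 // ?lerDl ?lerDr sqr_ge0.
Qed.

(** ['i] times the sum of [wave_op], [damping_op B] and [potential_op C] is the first-order form of
    [u'' + i B u' + (A + C) u = 0]. *)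
Definition potential_op (C : X -> X) (y : X * X) : X * X :=
  (0, (Complex 0 1) *: C y.1).

Lemma potential_lin C : lin_on setT DS C -> lin_on energy_dom energy_dom (potential_op C).
Proof.
move=> [_ [_ [CD CZ]]]; split=> //; split; first exact: energy_subspace.
split=> [x y x1 y1|k x x1]; apply: injective_projections => /=.
- by rewrite addr0.
- by rewrite CD // scalerDr.
- by rewrite scaler0.
- by rewrite CZ // !scalerA mulrC.
Qed.

Lemma potential_bound C (c d : R) :
  (forall xi, DS xi ->
     nrmX (C xi) ^+ 2 <= c ^+ 2 * nrmX (S xi) ^+ 2 + d ^+ 2 * nrmX xi ^+ 2) ->
  forall y, energy_dom y ->
    nrmY (potential_op C y) <= Num.sqrt (c ^+ 2 + d ^+ 2 / eps) * nrmY y.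
Proof.
move=> rel y Dy; rewrite nrmY_inr (nrmZ hX) // normc_def /=.
rewrite expr0n /= add0r expr1n sqrtr1 mul1r.
have M0 : 0 <= c ^+ 2 + d ^+ 2 / eps.
  by rewrite addr_ge0 ?divr_ge0 ?sqr_ge0 // ltW.
rewrite -(@ler_pXn2r _ 2) ?nnegrE ?mulr_ge0 ?nrm_ge0 ?sqrtr_ge0 //.
rewrite exprMn (sqr_sqrtr M0); apply: le_trans (rel _ Dy) _.
apply: (@le_trans _ _ ((c ^+ 2 + d ^+ 2 / eps) * nrmX (S y.1) ^+ 2)); last first.
  by apply: ler_wpM2l => //; rewrite nrmY_sq lerDl sqr_ge0.
(* [S_lower] reads [|y.1|^2 <= |S y.1|^2 / eps], which produces the summand [d^2 / eps]. *)
rewrite mulrDl lerD2l -mulrA; apply: ler_wpM2l; first exact: sqr_ge0.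
by rewrite -ler_pdivrMl ?invr_gt0 // invrK; apply: S_lower.
Qed.

End WaveOperator.

Theorem theorem3 (R : realType) (X : lmodType R[i]) (ipX : X -> X -> R[i])
  (DA : set X) (A : X -> X) (DS : set X) (S : X -> X)
  (B Cop : X -> X) (eps a b c d : R) :
  (* X is a nontrivial complex Hilbert space *)
  hilbert_on ipX setT -> (exists x : X, x <> 0) ->
  (* A densely defined, self-adjoint, bounded below by eps > 0 *)
  self_adjoint_on ipX setT DA A -> 0 < eps ->
  (forall xi, DA xi -> eps%:C * ipX xi xi <= ipX xi (A xi)) ->
  (* S = A^{1/2}: positive self-adjoint square root of A *)
  self_adjoint_on ipX setT DS S ->
  (forall xi, DS xi -> 0 <= ipX xi (S xi)) ->
  (forall xi, DA xi <-> (DS xi /\ DS (S xi))) ->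
  (forall xi, DA xi -> A xi = S (S xi)) ->
  (* B : D(A^{1/2}) -> X linear, relatively bounded *)
  lin_on setT DS B -> 0 <= a -> a < 1 ->
  (forall xi, DS xi ->
     nrm ipX (B xi) ^+ 2 <= a ^+ 2 * nrm ipX (S xi) ^+ 2 + b ^+ 2 * nrm ipX xi ^+ 2) ->
  (* C : D(A^{1/2}) -> X linear, relatively bounded *)
  lin_on setT DS Cop ->
  (forall xi, DS xi ->
     nrm ipX (Cop xi) ^+ 2 <= c ^+ 2 * nrm ipX (S xi) ^+ 2 + d ^+ 2 * nrm ipX xi ^+ 2) ->
  let DY : set (X * X)%type := [set y | DS y.1] in
  let ipY : X * X -> X * X -> R[i] :=
    fun y z => ipX (S y.1) (S z.1) + ipX y.2 z.2 in
  let DH : set (X * X)%type := [set y | DA y.1 /\ DS y.2] in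
  let H : X * X -> X * X := fun y => (- (Complex 0 1) *: y.2, (Complex 0 1) *: A y.1) in
  let Bh : X * X -> X * X := fun y => (0, - B y.2) in
  let Vop : X * X -> X * X := fun y => (0, (Complex 0 1) *: Cop y.1) in
  (* (i) *)
  hilbert_on ipY DY /\
  (* (ii) *)
  (dense_in ipY DY DH /\ lin_on DY DH H /\ self_adjoint_on ipY DY DH H) /\
  (* (iii) *)
  (lin_on DY DH Bh /\
   (symmetric_on ipX setT DS B -> symmetric_on ipY DY DH Bh) /\
   (bounded_on ipX DS B ->
      bounded_on ipY DH Bh /\ opnorm ipY DH Bh <= opnorm ipX DS B)) /\
  (* (iv) *)
  (closed_op ipY DY DH (fun y => H y + Bh y) /\
   (symmetric_on ipX setT DS B ->
      self_adjoint_on ipY DY DH (fun y => H y + Bh y))) /\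
  (* (v) *)
  (lin_on DY DY Vop /\ bounded_on ipY DY Vop /\
   opnorm ipY DY Vop <= Num.sqrt (c ^+ 2 + d ^+ 2 / eps)).
Proof.
move=> hX _ Asa eps0 Alower Ssa _ DAE AE lB a0 a1 Brel lC Crel.
move=> DY ipY DH H Bh Vop.
(* From here the general operator lemmas apply with [E := DY] inside [X * X]. *)
have hY : hilbert_on ipY DY := energy_hilbert hX Asa eps0 Alower Ssa DAE AE.
have Hdense : dense_in ipY DY DH := wave_dom_dense hX Asa eps0 Alower Ssa DAE AE.
have Hlin : lin_on DY DH H := wave_op_lin Asa Ssa DAE.
have Hsa : self_adjoint_on ipY DY DH H :=
  wave_op_self_adjoint hX Asa eps0 Alower Ssa DAE AE.
have HY y : DH y -> DY (H y) := wave_op_energy Ssa y.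
have BY y : DH y -> DY (Bh y) := fun _ => damping_energy Ssa B y.
have Blin : lin_on DY DH Bh := damping_lin Asa Ssa DAE B lB.
have Bhrel := damping_rel_bound (DA := DA) (A := A) hX Ssa B a b Brel.
have Bsym : symmetric_on ipX setT DS B -> symmetric_on ipY DY DH Bh :=
  damping_symmetric hX Asa eps0 Alower Ssa DAE AE B.
have Vbound := potential_bound hX Asa eps0 Alower Ssa DAE AE Cop c d Crel.
split=> //; split=> //; split; first split=> //.
  split=> // Bbd; split; first exact: (damping_bounded hX Ssa).
  exact: (damping_opnorm hX Asa eps0 Alower Ssa DAE AE).
split; first split.
- exact: (closed_perturbation hY DH H Bh a b Hlin Blin HY BY
    (self_adjoint_closed hY _ _ Hsa HY) a0 a1 Bhrel).
- by move=> /Bsym Bs; exact: (kato_rellich hY DH H Bh a b).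
split; first exact: (potential_lin Ssa).
split; first by exists (Num.sqrt (c ^+ 2 + d ^+ 2 / eps)).
apply: (opnorm_le hY) => //; last exact: sqrtr_ge0.
by have [] := energy_subspace Ssa.
Qed.
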